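(* Let $\mathbb{K}\in\{\mathbb{R},\mathbb{C},\mathbb{H}\}$, let $m,n\ge 1$, and let $\mathcal{D}^L_U$, $\mathcal{D}^R_U$ be left and right general-diagonal scale functions on the elemental-nonzero $m\times n$ matrices over $\mathbb{K}$. For an elemental-nonzero $m\times n$ matrix $A$, define $$A^{-U} := \mathcal{D}^R_U[A]\cdot\bigl(\mathcal{D}^L_U[A]\cdot A\cdot \mathcal{D}^R_U[A]\bigr)^{\dagger}\cdot \mathcal{D}^L_U[A].$$ Then for every elemental-nonzero $m\times n$ matrix $A$ and all nonsingular diagonal matrices $D\in\mathbb{K}^{m\times m}$ and $E\in\mathbb{K}^{n\times n}$: 1. $A\,A^{-U}A = A$; 2. $A^{-U}A\,A^{-U} = A^{-U}$; 3. $(DAE)^{-U} = E^{-1}A^{-U}D^{-1}$; 4. $\operatorname{rank}[A^{-U}] = \operatorname{rank}[A]$.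
   Context: $\mathbb{H}$ denotes the quaternions. $X^{\dagger}$ denotes the Moore-Penrose pseudoinverse of $X$. A matrix is elemental-nonzero if none of its entries equals zero. A positive diagonal matrix is a diagonal matrix with strictly positive real diagonal entries; a unitary diagonal matrix is a diagonal matrix over $\mathbb{K}$ whose diagonal entries have absolute value $1$. Definition (general-diagonal scale functions). Functions $\mathcal{D}^L_U$, $\mathcal{D}^R_U$ assigning to each matrix $A$ in the class under consideration (here: elemental-nonzero $m\times n$ matrices) a positive diagonal matrix $\mathcal{D}^L_U[A]\in\mathbb{R}_+^{m\times m}$ and a positive diagonal matrix $\mathcal{D}^R_U[A]\in\mathbb{R}_+^{n\times n}$ are called left and right general-diagonal scale functions if they jointly satisfy, for all such $A$, all conformant positive diagonal matrices $D_+,E_+$, all conformant unitary diagonal matrices $D_u,D_v$, and all conformant permutation matrices $P,Q$: (i) $\mathcal{D}^L_U[D_+AE_+]\cdot(D_+AE_+)\cdot\mathcal{D}^R_U[D_+AE_+]=\mathcal{D}^L_U[A]\cdot A\cdot\mathcal{D}^R_U[A]$; (ii) $\mathcal{D}^L_U[PAQ]\cdot(PAQ)\cdot\mathcal{D}^R_U[PAQ]=P\cdot\{\mathcal{D}^L_U[A]\cdot A\cdot\mathcal{D}^R_U[A]\}\cdot Q$; (iii) $\mathcal{D}^L_U[D_uAD_v]=\mathcal{D}^L_U[A]$; (iv) $\mathcal{D}^R_U[D_uAD_v]=\mathcal{D}^R_U[A]$. *)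

(* Defs.v *)
From HB Require Import structures.
From mathcomp Require Import all_boot all_order all_algebra.
From mathcomp Require Import boolp classical_sets reals.
From mathcomp Require Import complex ring.
Set Implicit Arguments.
Unset Strict Implicit.
Unset Printing Implicit Defensive.
Import Order.TTheory GRing.Theory Num.Theory.
Local Open Scope ring_scope.

(* Quat a b c d stands for a + b i + c j + d k. *)
Record quaternion (R : Type) : Type :=
  Quat { qre : R; qi : R; qj : R; qk : R }.

Section Quaternion.
Variable R : realType.
Local Notation H := (quaternion R).

Definition quat_to_prod (x : H) : R * R * R * R :=
  let: Quat a b c d := x in (a, b, c, d).
Definition quat_of_prod (p : R * R * R * R) : H :=
  let: (a, b, c, d) := p in Quat a b c d.
Lemma quat_to_prodK : cancel quat_to_prod quat_of_prod.
Proof. by case. Qed.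

HB.instance Definition _ := Choice.copy H (can_type quat_to_prodK).

Definition addq (x y : H) : H :=
  let: Quat a1 b1 c1 d1 := x in let: Quat a2 b2 c2 d2 := y in
  Quat (a1 + a2) (b1 + b2) (c1 + c2) (d1 + d2).
Definition oppq (x : H) : H :=
  let: Quat a b c d := x in Quat (- a) (- b) (- c) (- d).
Definition mulq (x y : H) : H :=
  let: Quat a1 b1 c1 d1 := x in let: Quat a2 b2 c2 d2 := y in
  Quat (a1 * a2 - b1 * b2 - c1 * c2 - d1 * d2)
       (a1 * b2 + b1 * a2 + c1 * d2 - d1 * c2)
       (a1 * c2 - b1 * d2 + c1 * a2 + d1 * b2)
       (a1 * d2 + b1 * c2 - c1 * b2 + d1 * a2).
Definition realq (a : R) : H := Quat a 0 0 0.
Definition conjq (x : H) : H :=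
  let: Quat a b c d := x in Quat a (- b) (- c) (- d).
Definition normq (x : H) : R :=
  let: Quat a b c d := x in Num.sqrt (a ^+ 2 + b ^+ 2 + c ^+ 2 + d ^+ 2).

Lemma addqA : associative addq.
Proof. by move=> [????] [????] [????]; congr Quat; rewrite addrA. Qed.
Lemma addqC : commutative addq.
Proof. by move=> [????] [????]; congr Quat; rewrite addrC. Qed.
Lemma add0q : left_id (realq 0) addq.
Proof. by move=> [????]; congr Quat; rewrite add0r. Qed.
Lemma addNq : left_inverse (realq 0) oppq addq.
Proof. by move=> [????]; congr Quat; rewrite addNr. Qed.

HB.instance Definition _ := GRing.isZmodule.Build H addqA addqC add0q addNq.

Lemma mulqA : associative mulq.
Proof. by move=> [????] [????] [????] /=; congr Quat; ring. Qed.
Lemma mul1q : left_id (realq 1) mulq.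
Proof. by move=> [????] /=; congr Quat; ring. Qed.
Lemma mulq1 : right_id (realq 1) mulq.
Proof. by move=> [????] /=; congr Quat; ring. Qed.
Lemma mulqDl : left_distributive mulq addq.
Proof. by move=> [????] [????] [????] /=; congr Quat; ring. Qed.
Lemma mulqDr : right_distributive mulq addq.
Proof. by move=> [????] [????] [????] /=; congr Quat; ring. Qed.
Lemma oneq_neq0 : realq 1 != realq 0.
Proof. by apply/eqP => -[] /eqP; rewrite oner_eq0. Qed.

HB.instance Definition _ := GRing.Zmodule_isNzRing.Build H
  mulqA mul1q mulq1 mulqDl mulqDr oneq_neq0.

End Quaternion.

Inductive scalar_kind := RealK | ComplexK | QuaternionK.

Definition base_ring (R : realType) (k : scalar_kind) : nzRingType :=
  match k with
  | RealK => R
  | ComplexK => R[i]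
  | QuaternionK => quaternion R
  end.

Definition of_realK (R : realType) (k : scalar_kind) : R -> base_ring R k :=
  match k return R -> base_ring R k with
  | RealK => fun x => x
  | ComplexK => fun x => Complex x 0
  | QuaternionK => @realq R
  end.

Definition conjK (R : realType) (k : scalar_kind) :
    base_ring R k -> base_ring R k :=
  match k return base_ring R k -> base_ring R k with
  | RealK => fun x => x
  | ComplexK => fun x : R[i] => conjc x
  | QuaternionK => @conjq R
  end.

Definition absK (R : realType) (k : scalar_kind) : base_ring R k -> R :=
  match k return base_ring R k -> R with
  | RealK => fun x : R => `|x|
  | ComplexK => @ComplexField.Normc.normc R
  | QuaternionK => @normq R
  end.

(* mxrank and invmx need commutative scalars, so over a possibly
   noncommutative ring the rank and the inverse are defined from scratch;
   mxrk_mxrank and mxinv_invmx identify them with the library notions. *)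
Section RingMatrices.
Variable K : nzRingType.

(* The columns of A with index in S are linearly independent in the right
   K-module of column vectors (scalars multiply columns on the right). *)
Definition cols_indep m n (A : 'M[K]_(m, n)) (S : {set 'I_n}) : Prop :=
  forall c : 'cV[K]_n,
    (forall j, j \notin S -> c j 0 = 0) -> A *m c = 0 -> c = 0.

(* Dimension of the right column space; over a division ring it equals the
   dimension of the left row space. *)
Definition mxrk m n (A : 'M[K]_(m, n)) : nat :=
  (\max_(S : {set 'I_n} | `[< cols_indep A S >]) #|S|)%N.

Definition is_mxinv n (D X : 'M[K]_n) : Prop :=
  D *m X = 1%:M /\ X *m D = 1%:M.

Definition nonsingular n (D : 'M[K]_n) : Prop := exists X, is_mxinv D X.

(* The inverse of a nonsingular matrix; 0 on singular ones. *)
Definition mxinv n (D : 'M[K]_n) : 'M[K]_n :=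
  xget 0 [set X | is_mxinv D X]%classic.

Definition elemental_nonzero m n (A : 'M[K]_(m, n)) : Prop :=
  forall i j, A i j != 0.

End RingMatrices.

Lemma nonsingular_unitmx (F : fieldType) n (D : 'M[F]_n) :
  nonsingular D <-> D \in unitmx.
Proof.
split=> [[X [DX _]] | uD]; first by have [] := mulmx1_unit DX.
by exists (invmx D); split; rewrite ?mulmxV ?mulVmx.
Qed.

Lemma mxinv_invmx (F : fieldType) n (D : 'M[F]_n) :
  D \in unitmx -> mxinv D = invmx D.
Proof.
move=> uD; rewrite /mxinv; case: xgetP => [X _ [_ XD] | /(_ (invmx D))].
  by rewrite -[X]mulmx1 -(mulmxV uD) mulmxA XD mul1mx.
by case; split; rewrite ?mulmxV ?mulVmx.
Qed.

Lemma mxrk_mxrank (F : fieldType) m n (A : 'M[F]_(m, n)) :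
  mxrk A = \rank A.
Proof.
apply/eqP; rewrite eqn_leq; apply/andP; split.
  apply/bigmax_leqP => S /asboolP indS; rewrite -(mxrank_tr A).
  have submxS : (rowsub (fun i : 'I_#|S| => enum_val i) A^T <= A^T)%MS.
    by apply/row_subP => i; rewrite row_rowsub row_sub.
  suff /eqP <- : row_free (rowsub (fun i : 'I_#|S| => enum_val i) A^T).
    exact: mxrankS.
  apply: inj_row_free => v vA0.
  pose c : 'cV[F]_n := \col_j \sum_(i | enum_val i == j) v 0 i.
  have c0 : c = 0.
    apply: indS => [j jNS|].
      rewrite mxE big1 // => i /eqP ij; case/negP: jNS.
      by rewrite -ij enum_valP.
    apply/colP => a; move/rowP/(_ a): vA0; rewrite !mxE => vA0.
    rewrite -[RHS]vA0 (partition_big (@enum_val _ (mem S)) predT) //=.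
    apply: eq_bigr => j _; rewrite mxE mulr_sumr.
    by apply: eq_bigr => i /eqP <-; rewrite !mxE mulrC.
  apply/rowP => i; move/colP/(_ (enum_val i)): c0; rewrite !mxE.
  by rewrite (big_pred1 i) // => j; rewrite (inj_eq enum_val_inj).
rewrite -(mxrank_tr A); set f := maxrankfun A^T.
have finj : injective f by exact: maxrankfun_inj.
have <- : #|f @: 'I_(\rank A^T)| = \rank A^T by rewrite card_imset // card_ord.
apply: (@leq_bigmax_cond _ (fun S => `[< cols_indep A S >])
  (fun S : {set 'I_n} => #|S|)).
apply/asboolP => c csupp Ac0.
have cf0 : \row_i c (f i) 0 = 0.
  apply: (row_free_inj (maxrowsub_free A^T)); rewrite mul0mx.
  apply/rowP => a; move/colP/(_ a): Ac0; rewrite !mxE => Ac0.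
  rewrite -[RHS]Ac0 [RHS](bigID [in f @: 'I_(\rank A^T)]) /=.
  rewrite [X in _ = _ + X]big1 ?addr0 => [|j jNf]; last first.
    by rewrite csupp // mulr0.
  rewrite big_imset /=; last by move=> x y _ _ /finj.
  by apply: eq_bigr => i _; rewrite !mxE mulrC.
apply/colP => j; rewrite [RHS]mxE.
have [/imsetP[i _ ->] | /csupp //] := boolP (j \in f @: 'I_(\rank A^T)).
by move/rowP/(_ i): cf0; rewrite !mxE.
Qed.

Section ScaleFunctions.
Variables (R : realType) (k : scalar_kind).
Local Notation K := (base_ring R k).

Definition adjmx m n (A : 'M[K]_(m, n)) : 'M[K]_(n, m) :=
  (map_mx (@conjK R k) A)^T.

(* The four Penrose equations. *)
Definition is_pinv m n (A : 'M[K]_(m, n)) (X : 'M[K]_(n, m)) : Prop :=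
  [/\ A *m X *m A = A,
      X *m A *m X = X,
      adjmx (A *m X) = A *m X &
      adjmx (X *m A) = X *m A].

(* The Moore-Penrose pseudoinverse; xget selects the unique solution. *)
Definition mppinv m n (A : 'M[K]_(m, n)) : 'M[K]_(n, m) :=
  xget 0 [set X | is_pinv A X]%classic.

Definition pos_diag n (D : 'M[K]_n) : Prop :=
  is_diag_mx D /\ forall i, exists2 r : R, 0 < r & D i i = of_realK k r.

Definition unitary_diag n (D : 'M[K]_n) : Prop :=
  is_diag_mx D /\ forall i, absK (D i i) = 1.

(* DL and DR are total functions, but they are constrained only on
   elemental-nonzero matrices, a class that is stable under all the
   transformations below. *)
Record scale_functions m n
    (DL : 'M[K]_(m, n) -> 'M[K]_m) (DR : 'M[K]_(m, n) -> 'M[K]_n) : Prop :=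
  ScaleFunctions {
    scale_posL : forall A, elemental_nonzero A -> pos_diag (DL A);
    scale_posR : forall A, elemental_nonzero A -> pos_diag (DR A);
    scale_inv : forall A D E, elemental_nonzero A -> pos_diag D -> pos_diag E ->
      let B := D *m A *m E in
      DL B *m B *m DR B = DL A *m A *m DR A;
    scale_perm : forall A P Q, elemental_nonzero A ->
      is_perm_mx P -> is_perm_mx Q ->
      let B := P *m A *m Q in
      DL B *m B *m DR B = P *m (DL A *m A *m DR A) *m Q;
    scale_unitaryL : forall A D E, elemental_nonzero A ->
      unitary_diag D -> unitary_diag E -> DL (D *m A *m E) = DL A;
    scale_unitaryR : forall A D E, elemental_nonzero A ->
      unitary_diag D -> unitary_diag E -> DR (D *m A *m E) = DR A
  }.

(* The generalized inverse A^{-U} determined by DL and DR. *)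
Definition uinv m n (DL : 'M[K]_(m, n) -> 'M[K]_m)
    (DR : 'M[K]_(m, n) -> 'M[K]_n) (A : 'M[K]_(m, n)) : 'M[K]_(n, m) :=
  DR A *m mppinv (DL A *m A *m DR A) *m DL A.

End ScaleFunctions.

(* Main.v *)
Require Import Defs.
From HB Require Import structures.
From mathcomp Require Import all_boot all_order all_algebra.
From mathcomp Require classical_sets.
From mathcomp Require Import boolp reals.
From mathcomp Require Import complex ring.
Set Implicit Arguments.
Unset Strict Implicit.
Unset Printing Implicit Defensive.
Import Order.TTheory GRing.Theory Num.Theory.
Local Open Scope ring_scope.

(* Write S for the scaled matrix DL[A] A DR[A].  The first two identities are
   Penrose equations for S with the invertible factors DL[A], DR[A] moved
   around, and they give the rank equality since the rank of a product is at
   most that of each factor.  For the third, split D and E into unitary and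
   positive diagonal parts.  The unitary parts pass through the pseudoinverse
   and commute with the real diagonal scalings.  For the positive parts D+, E+,
   the equality of the scaled matrices of D+ A E+ and A, read entrywise at the
   nonzero entries of A, gives DL[D+ A E+] D+ = c DL[A] and
   E+ DR[D+ A E+] = c^-1 DR[A] for a single constant c, which cancels. *)

(** * Scalar arithmetic common to the real, complex and quaternionic cases *)

Section Scalars.
Variables (R : realType) (k : scalar_kind).
Local Notation K := (base_ring R k).
Local Notation ofR := (@of_realK R k).
Local Notation conj := (@conjK R k).

Fact of_realK_is_zmod_morphism : zmod_morphism ofR.
Proof.
by case: k => [||] x y //=; rewrite -[RHS]/(_ + - _) /=; [congr Complex | congr Quat];
  rewrite subr0.
Qed.

Fact of_realK_is_monoid_morphism : monoid_morphism ofR.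
Proof.
case: k => /=; split=> // x y; first by congr Complex; ring.
by congr Quat; ring.
Qed.

HB.instance Definition _ :=
  GRing.isZmodMorphism.Build R K ofR of_realK_is_zmod_morphism.
HB.instance Definition _ :=
  GRing.isMonoidMorphism.Build R K ofR of_realK_is_monoid_morphism.

Fact conjK_is_zmod_morphism : zmod_morphism conj.
Proof.
case: k => [||] //=; first by move=> [??] [??]; congr Complex; rewrite opprD.
by move=> [????] [????]; congr Quat; rewrite opprD.
Qed.

HB.instance Definition _ :=
  GRing.isZmodMorphism.Build K K conj conjK_is_zmod_morphism.

Lemma conjKM (x y : K) : conj (x * y) = conj y * conj x.
Proof.
move: x y; case: k => /= [x y|[a b] [c d]|[????] [????]].
- exact: mulrC.
- by congr Complex; ring.
- by congr Quat; ring.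
Qed.

Lemma conjK_of_real (r : R) : conj (ofR r) = ofR r.
Proof.
by case: k => //=; [congr Complex | congr Quat]; rewrite oppr0.
Qed.

Lemma conjKK : involutive conj.
Proof.
case: k => /= [|[a b]|[a b c d]] //; first by congr Complex; rewrite opprK.
by congr Quat; rewrite opprK.
Qed.

(** Centrality of the reals is what lets real diagonal scalings move past quaternion entries and
    unitary diagonal factors. *)
Lemma of_realKC (r : R) (x : K) : ofR r * x = x * ofR r.
Proof.
move: x; case: k => /= [x|[a b]|[a b c d]].
- exact: mulrC.
- by congr Complex; ring.
- by congr Quat; ring.
Qed.

Lemma of_realK_inj : injective ofR.
Proof. by case: k => x y //= []. Qed.

Lemma absK_ge0 (x : K) : 0 <= absK x.
Proof.
by move: x; case: k => /= [x|[a b]|[a b c d]]; rewrite ?normr_ge0 ?sqrtr_ge0.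
Qed.

Lemma conjK_mulV (x : K) : conj x * x = ofR (absK x ^+ 2).
Proof.
move: x; case: k => /= [x|[a b]|[a b c d]].
- by rewrite real_normK ?num_real.
- rewrite sqr_sqrtr ?addr_ge0 ?sqr_ge0 //.
  by congr Complex; ring.
- rewrite sqr_sqrtr ?addr_ge0 ?sqr_ge0 //.
  by congr Quat; ring.
Qed.

Lemma absK_eq0 (x : K) : (absK x == 0) = (x == 0).
Proof.
apply/eqP/eqP => [|->].
  move: x; case: k => /= [x /eqP|[a b]|[a b c d]].
  - by rewrite normr_eq0 => /eqP.
  - by move/ComplexField.Normc.eq0_normc.
  - move/eqP; rewrite sqrtr_eq0 => le0.
    have /eqP : a ^+ 2 + b ^+ 2 + c ^+ 2 + d ^+ 2 = 0.
      by apply/eqP; rewrite eq_le le0 !addr_ge0 ?sqr_ge0.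
    rewrite !paddr_eq0 ?addr_ge0 ?sqr_ge0 // !sqrf_eq0.
    by case/andP => /andP[/andP[/eqP-> /eqP->] /eqP->] /eqP->.
have /of_realK_inj/eqP : ofR (absK (0 : K) ^+ 2) = ofR 0.
  by rewrite -conjK_mulV mulr0 rmorph0.
by rewrite sqrf_eq0 => /eqP.
Qed.

(** Both sides are nonnegative, so it suffices to compare squares, and these are computed inside [K]
    as [conj x * x]. *)
Lemma absK_of_realM (r : R) (x : K) : 0 <= r -> absK (ofR r * x) = r * absK x.
Proof.
move=> r_ge0; apply/eqP; rewrite -(@eqrXn2 _ 2) ?absK_ge0 ?mulr_ge0 ?absK_ge0 //.
apply/eqP/of_realK_inj.
rewrite -conjK_mulV conjKM conjK_of_real mulrA -(mulrA (conj x)).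
by rewrite -rmorphM -of_realKC -mulrA conjK_mulV -rmorphM exprMn.
Qed.

Lemma absK_conj (x : K) : absK (conj x) = absK x.
Proof.
by move: x; case: k => /= [x|[a b]|[a b c d]] //=; rewrite !sqrrN.
Qed.

(** The inverse is the conjugate divided by the squared absolute value. It is two-sided because the
    real factor is central and conjugation preserves [absK]. *)
Lemma base_ring_inv (x : K) : x != 0 -> exists y, y * x = 1 /\ x * y = 1.
Proof.
move=> x0; have ax0 : absK x ^+ 2 != 0 by rewrite sqrf_eq0 absK_eq0.
exists (ofR (absK x ^+ 2)^-1 * conj x); split.
  by rewrite -mulrA conjK_mulV -rmorphM mulVf // rmorph1.
rewrite of_realKC mulrA -{1}(conjKK x) conjK_mulV absK_conj -rmorphM mulfV //.
by rewrite rmorph1.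
Qed.

End Scalars.

(** * Rank over a division ring, with scalars acting on columns from the right *)

Section DivisionRingRank.
Variable K : nzRingType.
Hypothesis K_inv : forall x : K, x != 0 -> exists y, y * x = 1 /\ x * y = 1.

(** Gaussian elimination, by induction on the number of rows: a zero top row is dropped, otherwise a
    nonzero entry of it serves as pivot. *)
Lemma nontrivial_kernel m n (M : 'M[K]_(m, n)) :
  (m < n)%N -> exists2 c : 'cV[K]_n, c != 0 & M *m c = 0.
Proof.
elim: m n M => [|m IHm] [|n] M // lt_mn.
  exists (const_mx 1); last by rewrite [M]flatmx0 mul0mx.
  by apply/eqP => /colP/(_ 0)/eqP; rewrite !mxE oner_eq0.
have [M0|/existsP[j Mj0]] := boolP [forall j, M 0 j == 0].
  have [c c0 Mc] := IHm n.+1 (row' 0 M) (ltnW lt_mn).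
  exists c => //; apply/colP => i; rewrite !mxE.
  have [i' ->|->] := unliftP 0 i; last first.
    by rewrite big1 // => j _; rewrite (eqP (forallP M0 j)) mul0r.
  by move/colP/(_ i'): Mc; rewrite !mxE; under eq_bigr do rewrite mxE.
have [p [_ Mp]] := K_inv Mj0.
(* [N] is the Schur complement of the pivot [M 0 j]; the order of the factors matters, [p] being
   used as a right inverse of the pivot. *)
pose N : 'M[K]_(m, n) := \matrix_(i, l)
  (M (lift 0 i) (lift j l) - M (lift 0 i) j * (p * M 0 (lift j l))).
have [c c0 Nc] := IHm n N lt_mn.
pose s := \sum_l M 0 (lift j l) * c l 0.
(* The coordinate at [j] is chosen so that the top row kills [e]; the other rows then reduce to
   [N *m c = 0]. *)
pose e : 'cV[K]_n.+1 :=
  \col_l (if unlift j l is Some l' then c l' 0 else - (p * s)).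
have ej : e j 0 = - (p * s) by rewrite mxE unlift_none.
have el l : e (lift j l) 0 = c l 0 by rewrite mxE liftK.
exists e.
  apply: contra c0 => /eqP e0; apply/eqP/colP => l.
  by rewrite -el e0 !mxE.
apply/colP => i; rewrite !mxE (bigD1_ord j) //= ej.
under eq_bigr do rewrite el.
have [i' ->|->] := unliftP 0 i; last by rewrite mulrN mulrA Mp mul1r addNr.
move/colP/(_ i'): Nc; rewrite !mxE => Nc; rewrite -[RHS]Nc.
under [RHS]eq_bigr do rewrite mxE mulrBl.
rewrite sumrB addrC mulrN; congr (_ - _).
by rewrite !mulr_sumr; apply: eq_bigr => l _; rewrite -!mulrA.
Qed.

Lemma cols_indep_mxrk m n (A : 'M[K]_(m, n)) S :
  cols_indep A S -> (#|S| <= mxrk A)%N.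
Proof.
move=> indS.
apply: (@leq_bigmax_cond _ (fun S => `[< cols_indep A S >])
  (fun S : {set 'I_n} => #|S|)); exact/asboolP.
Qed.

(** The maximum is attained because the empty set of columns is independent. *)
Lemma mxrk_cols_indep m n (A : 'M[K]_(m, n)) :
  exists2 S, cols_indep A S & #|S| = mxrk A.
Proof.
have ind0 : cols_indep A set0.
  by move=> c c0 _; apply/colP => j; rewrite mxE c0 ?inE.
have [|S /asboolP indS eqS] :=
  @eq_bigmax_cond _ (fun S => `[< cols_indep A S >])
    (fun S : {set 'I_n} => #|S|).
  by apply/card_gt0P; exists set0; apply/asboolP.
by exists S.
Qed.

(** A linear relation among columns of [A] is also one among the same columns of [B *m A]. *)
Lemma mxrk_mulmxl m n p (B : 'M[K]_(p, m)) (A : 'M[K]_(m, n)) :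
  (mxrk (B *m A) <= mxrk A)%N.
Proof.
have [S indS <-] := mxrk_cols_indep (B *m A).
apply: cols_indep_mxrk => c cS Ac0; apply: indS => //.
by rewrite -mulmxA Ac0 mulmx0.
Qed.

(** A maximal independent set [T] of columns spans: adding a column outside [T] creates a relation
    whose coefficient at that column is nonzero, hence invertible. The coefficient matrix [C] has
    nonzero rows only in [T]. *)
Lemma cols_span m n (A : 'M[K]_(m, n)) :
  exists (T : {set 'I_n}) (C : 'M[K]_n),
    [/\ #|T| = mxrk A, A = A *m C & forall i j, i \notin T -> C i j = 0].
Proof.
have [T indT cardT] := mxrk_cols_indep A; exists T.
suff /choice[u uP] : forall j, exists u : 'cV[K]_n,
    A *m u = col j A /\ forall i, i \notin T -> u i 0 = 0.
  exists (\matrix_(i, j) u j i 0); split=> //.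
    apply/matrixP => i j; have [/colP/(_ i)] := uP j.
    by rewrite !mxE => <- _; apply: eq_bigr => l _; rewrite mxE.
  by move=> i j iT; rewrite mxE; have [_ ->] := uP j.
move=> j; have [jT|jT] := boolP (j \in T).
  exists (delta_mx j 0); split; first by rewrite colE.
  move=> i iT; rewrite mxE; case: eqP => //= ij.
  by rewrite ij jT in iT.
have /asboolPn : ~ cols_indep A (j |: T).
  by move=> /cols_indep_mxrk; rewrite cardsU1 jT cardT ltnn.
move=> /asboolPn/existsNP[c] /not_implyP[cS] /not_implyP[Ac0] /eqP c0.
have [cj0|cj0] := eqVneq (c j 0) 0.
  case/eqP: c0; apply: indT => // i iT.
  by have [->//|ij] := eqVneq i j; apply: cS; rewrite !inE negb_or ij.
have [y [_ cy]] := K_inv cj0.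
(* Right multiplication by [y] keeps [c] in the kernel of [A] and normalizes its coordinate at [j]
   to 1, so the difference vanishes there. *)
exists (delta_mx j 0 - c *m y%:M); split.
  by rewrite mulmxBr mulmxA Ac0 mul0mx subr0 colE.
move=> i iT; rewrite !mxE big_ord1 !mxE eqxx andbT mulr1n.
have [->|ij] := eqVneq i j; first by rewrite cy subrr.
by rewrite cS ?mul0r ?subr0 // !inE negb_or ij.
Qed.

(** Since [A *m B] factors through the columns of [A] in [T], more than [#|T|] of its columns would
    be related by a kernel vector of a matrix with [#|T|] rows. *)
Lemma mxrk_mulmxr m n p (A : 'M[K]_(m, n)) (B : 'M[K]_(n, p)) :
  (mxrk (A *m B) <= mxrk A)%N.
Proof.
have [S indS <-] := mxrk_cols_indep (A *m B).
have [T [C [<- defA CT]]] := cols_span A.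
rewrite leqNgt; apply/negP => /nontrivial_kernel K_lt.
pose M : 'M[K]_(#|T|, #|S|) := \matrix_(i, j) (C *m B) (enum_val i) (enum_val j).
have [c c0 Mc] := K_lt M.
(* [e] is [c] extended by zero outside [S]. *)
pose e : 'cV[K]_p := \col_j \sum_(i | enum_val i == j) c i 0.
have e_val i : e (enum_val i) 0 = c i 0.
  by rewrite mxE (big_pred1 i) // => l; rewrite (inj_eq enum_val_inj).
have eS j : j \notin S -> e j 0 = 0.
  move=> jS; rewrite mxE big1 // => i /eqP ij.
  by rewrite -ij enum_valP in jS.
(* Rows outside [T] vanish with those of [C]; rows in [T] are the rows of [M] applied to [c]. *)
have CBe : C *m B *m e = 0.
  apply/colP => i; rewrite [RHS]mxE.
  have [iT|iT] := boolP (i \in T); last first.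
    rewrite -mulmxA mxE big1 // => l _; by rewrite CT // mul0r.
  move/colP/(_ (enum_rank_in iT i)): Mc; rewrite [RHS]mxE => <-.
  rewrite !mxE [LHS](bigID [in S]) /= [X in _ + X]big1 ?addr0; last first.
    by move=> j jS; rewrite eS ?mulr0.
  rewrite big_enum_val /=; apply: eq_bigr => j _.
  by rewrite e_val [M _ _]mxE enum_rankK_in.
have e0 : e = 0.
  by apply: indS => //; rewrite defA -!(mulmxA A) CBe mulmx0.
by case/eqP: c0; apply/colP => i; rewrite -e_val e0 !mxE.
Qed.

Lemma mxrk_reflexive_inverse m n (A : 'M[K]_(m, n)) (X : 'M[K]_(n, m)) :
  A *m X *m A = A -> X *m A *m X = X -> mxrk X = mxrk A.
Proof.
move=> AXA XAX; apply/eqP; rewrite eqn_leq; apply/andP; split.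
  rewrite -{1}XAX -mulmxA; apply: leq_trans (mxrk_mulmxl _ _) _.
  exact: mxrk_mulmxr.
rewrite -{1}AXA -mulmxA; apply: leq_trans (mxrk_mulmxl _ _) _.
exact: mxrk_mulmxr.
Qed.

End DivisionRingRank.

(** * Adjoints, and existence and uniqueness of the Moore-Penrose pseudoinverse *)

Section MoorePenrose.
Variables (R : realType) (k : scalar_kind).
Local Notation K := (base_ring R k).
Local Notation ofR := (@of_realK R k).

Lemma adjmxM m n p (A : 'M[K]_(m, n)) (B : 'M[K]_(n, p)) :
  adjmx (A *m B) = adjmx B *m adjmx A.
Proof.
apply/matrixP => i j; rewrite !mxE raddf_sum.
by apply: eq_bigr => l _; rewrite !mxE; exact: conjKM.
Qed.

Lemma adjmxD m n (A B : 'M[K]_(m, n)) : adjmx (A + B) = adjmx A + adjmx B.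
Proof. by apply/matrixP => i j; rewrite !mxE raddfD. Qed.

Lemma adjmxN m n (A : 'M[K]_(m, n)) : adjmx (- A) = - adjmx A.
Proof. by apply/matrixP => i j; rewrite !mxE raddfN. Qed.

Lemma adjmxB m n (A B : 'M[K]_(m, n)) : adjmx (A - B) = adjmx A - adjmx B.
Proof. by rewrite adjmxD adjmxN. Qed.

Lemma adjmxK m n (A : 'M[K]_(m, n)) : adjmx (adjmx A) = A.
Proof. by apply/matrixP => i j; rewrite !mxE conjKK. Qed.

Lemma adjmx0 m n : adjmx (0 : 'M[K]_(m, n)) = 0.
Proof. by apply/matrixP => i j; rewrite !mxE raddf0. Qed.

Lemma adjmx1 n : adjmx (1%:M : 'M[K]_n) = 1%:M.
Proof.
apply/matrixP => i j; rewrite !mxE eq_sym.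
by case: eqP => _; rewrite ?mulr1n ?mulr0n ?raddf0 // -(rmorph1 ofR) conjK_of_real.
Qed.

Lemma adjmxZ_real m n r (A : 'M[K]_(m, n)) :
  adjmx (ofR r *: A) = ofR r *: adjmx A.
Proof.
by apply/matrixP => i j; rewrite !mxE conjKM conjK_of_real of_realKC.
Qed.

(** The operation [*:] scales on the left, and crosses [A] here because real scalars are central. *)
Lemma scalemxAr_real m n p r (A : 'M[K]_(m, n)) (B : 'M[K]_(n, p)) :
  A *m (ofR r *: B) = ofR r *: (A *m B).
Proof.
apply/matrixP => i j; rewrite !mxE mulr_sumr; apply: eq_bigr => l _.
by rewrite !mxE mulrA -of_realKC mulrA.
Qed.

Lemma adj_col_mul n (v : 'cV[K]_n) :
  adjmx v *m v = ofR (\sum_i absK (v i 0) ^+ 2) *: 1%:M.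
Proof.
apply/matrixP => i j; rewrite !ord1 !mxE mulr1 raddf_sum /=.
by apply: eq_bigr => l _; rewrite !mxE conjK_mulV.
Qed.

Lemma adj_col_gt0 n (v : 'cV[K]_n) : v != 0 -> 0 < \sum_i absK (v i 0) ^+ 2.
Proof.
move=> v0; rewrite lt_def sumr_ge0 ?andbT => [|i _]; last exact: sqr_ge0.
apply: contra v0; rewrite psumr_eq0 => [/allP s0|i _]; last exact: sqr_ge0.
apply/eqP/colP => i; rewrite mxE; apply/eqP.
by rewrite -absK_eq0 -sqrf_eq0; apply: s0; rewrite mem_index_enum.
Qed.

(** Taking adjoints of [X *m A = (X *m A) *m (Y *m A)] reverses the Hermitian factors and yields
    [Y *m A]; likewise [A *m X = A *m Y]. Hence [X = XAX = YAX = YAY = Y]. *)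
Lemma is_pinv_unique m n (A : 'M[K]_(m, n)) X Y :
  is_pinv A X -> is_pinv A Y -> X = Y.
Proof.
move=> [AX XA hAX hXA] [AY YA hAY hYA].
have XAYA : X *m A = Y *m A.
  by rewrite -hXA -{1}AY -mulmxA mulmxA adjmxM hXA hYA -mulmxA (mulmxA A) AX.
have AXAY : A *m X = A *m Y.
  by rewrite -hAX -{1}AY -(mulmxA (A *m Y)) adjmxM hAX hAY mulmxA AX.
by rewrite -XA XAYA -mulmxA AXAY mulmxA YA.
Qed.

(** The column step of Greville's recursion: [c] is the residual of [a] after projection onto the
    column space of [B]. The conditions on [b] are blockwise forms of the Penrose equations, phrased
    to serve both choices of [b] below. *)
Lemma is_pinv_row_mx m n (a : 'cV[K]_m) (B : 'M[K]_(m, n)) X b :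
    is_pinv B X -> let d := X *m a in let c := a - B *m d in
    c *m b *m a = c -> c *m b *m B = 0 -> b *m B *m X + b *m c *m b = b ->
    adjmx (c *m b) = c *m b -> adjmx (b *m a) = b *m a ->
    adjmx (d *m b *m B) = d *m b *m B -> adjmx (b *m B) = d - d *m b *m a ->
  is_pinv (row_mx a B) (col_mx b (X - d *m b)).
Proof.
move=> [BXB XBX hBX hXB] d c cba cbB bBX hcb hba hdbB hbB.
have cE : c = a - B *m d by [].
clearbody c; have Xc : X *m c = 0 by rewrite cE mulmxBr /d !mulmxA XBX subrr.
have AX : row_mx a B *m col_mx b (X - d *m b) = B *m X + c *m b.
  by rewrite mul_row_col mulmxBr cE mulmxBl !mulmxA addrCA addrA.
(* The last hypothesis makes the off-diagonal blocks adjoint to each other, as Hermitian symmetry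
   demands. *)
have XA : col_mx b (X - d *m b) *m row_mx a B =
    block_mx (b *m a) (b *m B) (adjmx (b *m B)) (X *m B - d *m b *m B).
  by rewrite mul_col_row hbB !mulmxBl.
split.
- rewrite AX mul_mx_row !mulmxDl cba cbB BXB addr0; congr row_mx.
  by rewrite cE /d mulmxA addrC subrK.
- rewrite -mulmxA AX mul_col_mx; congr col_mx; first by rewrite mulmxDr !mulmxA.
  rewrite mulmxBl; congr (_ - _); first by rewrite mulmxDr !mulmxA XBX Xc mul0mx addr0.
  by rewrite -mulmxA mulmxDr !mulmxA bBX.
- by rewrite AX adjmxD hBX hcb.
- rewrite XA {1}/adjmx map_block_mx tr_block_mx -!/(adjmx _) adjmxK hba.
  by rewrite adjmxB hXB hdbB.
Qed.

(* Greville's recursion on the columns: [row_mx a B] is treated according to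
   whether [a] lies in the column space of [B]. *)
Lemma is_pinv_exists m n (A : 'M[K]_(m, n)) : exists X, is_pinv A X.
Proof.
elim: n A => [|n IHn] A.
  by exists 0; split; rewrite ?mulmx0 ?mul0mx ?adjmx0 // [A]thinmx0.
have [a [B ->]] : exists (a : 'cV[K]_m) (B : 'M[K]_(m, n)), A = row_mx a B.
  by exists (lsubmx (A : 'M_(m, 1 + n))), (rsubmx (A : 'M_(m, 1 + n)));
    rewrite hsubmxK.
have [X XP] := IHn B; have [BXB XBX hBX hXB] := XP.
pose d := X *m a; pose c := a - B *m d.
suff [b bP] : exists b, is_pinv (row_mx a B) (col_mx b (X - d *m b)).
  by exists (col_mx b (X - d *m b)).
have [c0|c0] := eqVneq c 0.
  have aE : a = B *m d by apply/eqP; rewrite -subr_eq0 -/c c0.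
  have XBd : X *m B *m d = d by rewrite /d mulmxA XBX.
  have dXB : adjmx d *m X *m B = adjmx d by rewrite -mulmxA -hXB -adjmxM XBd.
  have := adj_col_mul d; set r := \sum_i _ => dd.
  have r1_neq0 : 1 + r != 0.
    by rewrite gt_eqF // ltr_wpDr // sumr_ge0 // => i _; apply: sqr_ge0.
  (* Here [col_mx 1 (- d)] lies in the kernel of [row_mx a B] and has squared norm [1 + r]; this [b]
     results from removing from [col_mx 0 X] its component along that vector. *)
  pose b := ofR (1 + r)^-1 *: (adjmx d *m X); exists b.
  have bB : b *m B = ofR (1 + r)^-1 *: adjmx d by rewrite -scalemxAl dXB.
  have ba : b *m a = ofR ((1 + r)^-1 * r) *: 1%:M.
    by rewrite aE mulmxA bB -scalemxAl dd scalerA -rmorphM.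
  apply: is_pinv_row_mx => //; rewrite -/d -/c ?c0 ?mul0mx ?mulmx0 ?adjmx0 //.
  - by rewrite bB -scalemxAl mul0mx addr0.
  - by rewrite ba adjmxZ_real adjmx1.
  - by rewrite -mulmxA bB scalemxAr_real adjmxZ_real adjmxM adjmxK.
  - rewrite -mulmxA ba bB scalemxAr_real mulmx1 adjmxZ_real adjmxK.
    rewrite -[X in _ = X - _]scale1r -(rmorph1 ofR) -scalerBl -rmorphB.
    by congr (ofR _ *: _); field.
have := adj_col_mul c; set r := \sum_i _ => cc.
have r0 : r != 0 by rewrite gt_eqF // adj_col_gt0.
(* This [b] is the pseudoinverse of the nonzero column [c]. *)
pose b := ofR r^-1 *: adjmx c; exists b.
have bc : b *m c = 1%:M.
  by rewrite -scalemxAl cc scalerA -rmorphM mulVf // rmorph1 scale1r.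
(* The residual [c] is orthogonal to the columns of [B], because [B *m X] is Hermitian and fixes
   [B]. *)
have bB : b *m B = 0.
  rewrite -scalemxAl adjmxB adjmxM /d.
  have -> : adjmx (X *m a) *m adjmx B = adjmx a *m (B *m X).
    by rewrite -adjmxM mulmxA adjmxM hBX.
  by rewrite mulmxBl -mulmxA BXB subrr scaler0.
have ba : b *m a = 1%:M.
  have -> : a = c + B *m d by rewrite subrK.
  by rewrite mulmxDr mulmxA bB mul0mx addr0.
apply: is_pinv_row_mx => //; rewrite -/d -/c.
- by rewrite -mulmxA ba mulmx1.
- by rewrite -mulmxA bB mulmx0.
- by rewrite bB mul0mx add0r bc mul1mx.
- by rewrite scalemxAr_real adjmxZ_real adjmxM adjmxK.
- by rewrite ba adjmx1.
- by rewrite -mulmxA bB mulmx0 adjmx0.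
- by rewrite bB adjmx0 -mulmxA ba mulmx1 subrr.
Qed.

Lemma mppinvP m n (A : 'M[K]_(m, n)) : is_pinv A (mppinv A).
Proof.
have [X XP] := is_pinv_exists A.
by rewrite /mppinv; case: classical_sets.xgetP => [Y _ //|/(_ X)].
Qed.

(** By uniqueness it suffices to check the Penrose equations; conjugation by a unitary matrix keeps
    the two products Hermitian. *)
Lemma mppinv_unitary m n (A : 'M[K]_(m, n)) (U : 'M[K]_m) (V : 'M[K]_n) :
    is_mxinv U (adjmx U) -> is_mxinv V (adjmx V) ->
  mppinv (U *m A *m V) = adjmx V *m mppinv A *m adjmx U.
Proof.
move=> [UU' U'U] [VV' V'V]; apply: is_pinv_unique (mppinvP _) _.
have [AXA XAX hAX hXA] := mppinvP A; set X := mppinv A in AXA XAX hAX hXA *.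
have AX : U *m A *m V *m (adjmx V *m X *m adjmx U) = U *m (A *m X) *m adjmx U.
  by rewrite -!mulmxA (mulmxA V) VV' mul1mx !mulmxA.
have XA : adjmx V *m X *m adjmx U *m (U *m A *m V) = adjmx V *m (X *m A) *m V.
  by rewrite -!mulmxA (mulmxA (adjmx U)) U'U mul1mx !mulmxA.
split.
- by rewrite AX -!mulmxA (mulmxA (adjmx U)) U'U mul1mx !mulmxA -(mulmxA U) -(mulmxA U) AXA.
- rewrite XA -!mulmxA (mulmxA V) VV' mul1mx !mulmxA.
  by rewrite -(mulmxA (adjmx V)) -(mulmxA (adjmx V)) XAX.
- by rewrite AX 2!adjmxM adjmxK hAX mulmxA.
- by rewrite XA 2!adjmxM adjmxK hXA mulmxA.
Qed.

End MoorePenrose.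

(** * Positive and unitary diagonal matrices, and uniqueness of a scaling up to a constant *)

Section DiagonalScaling.
Variables (R : realType) (k : scalar_kind).
Local Notation K := (base_ring R k).
Local Notation ofR := (@of_realK R k).
Local Notation rdiag d := (diag_mx (map_mx ofR d)).

(** Encoding by a real row vector moves computations with scale factors into the commutative field
    [R]. *)
Lemma pos_diagP n (D : 'M[K]_n) :
  pos_diag D <-> exists2 d : 'rV[R]_n, (forall i, 0 < d 0 i) & D = rdiag d.
Proof.
split=> [[/is_diag_mxP Dd Dp]|[d d0 ->]]; last first.
  split=> [|i]; first exact: diag_mx_is_diag.
  by exists (d 0 i); rewrite ?d0 // !mxE eqxx mulr1n.
have /choice[d dP] : forall i, exists r, 0 < r /\ D i i = ofR r.
  by move=> i; have [r] := Dp i; exists r.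
exists (\row_i d i) => [i|]; first by rewrite mxE; case: (dP i).
apply/matrixP => i j; rewrite !mxE; have [<-|ij] := eqVneq i j.
  by rewrite mulr1n; case: (dP i).
by rewrite mulr0n Dd.
Qed.

Lemma rdiagMM n (d e : 'rV[R]_n) :
  rdiag d *m rdiag e = rdiag (\row_i (d 0 i * e 0 i)).
Proof.
rewrite mulmx_diag; congr diag_mx; apply/rowP => i.
by rewrite !mxE rmorphM.
Qed.

Lemma rdiagC n (d : 'rV[R]_n) (D : 'M[K]_n) :
  is_diag_mx D -> rdiag d *m D = D *m rdiag d.
Proof.
move=> /is_diag_mxP Dd; rewrite mul_diag_mx mul_mx_diag.
apply/matrixP => i j; rewrite !mxE; have [<-|ij] := eqVneq i j.
  exact: of_realKC.
by rewrite Dd // mulr0 mul0r.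
Qed.

Lemma rdiag_scale_mul m n (c : R) (l : 'rV[R]_m) (A : 'M[K]_(m, n)) (r : 'rV[R]_n) :
  rdiag (c *: l) *m A *m rdiag r = rdiag l *m A *m rdiag (c *: r).
Proof.
rewrite !mul_diag_mx !mul_mx_diag; apply/matrixP => i j; rewrite !mxE.
rewrite -!of_realKC !mulrA -!rmorphM; congr (ofR _ * _); ring.
Qed.

Lemma elemental_nonzero_rdiag m n (A : 'M[K]_(m, n)) (d : 'rV[R]_m) (e : 'rV[R]_n) :
    elemental_nonzero A -> (forall i, 0 < d 0 i) -> (forall i, 0 < e 0 i) ->
  elemental_nonzero (rdiag d *m A *m rdiag e).
Proof.
move=> A_nz d0 e0 i j; rewrite mul_diag_mx mul_mx_diag !mxE -of_realKC.
by rewrite -absK_eq0 !absK_of_realM ?ltW // !mulf_neq0 ?absK_eq0 ?A_nz // gt_eqF.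
Qed.

(** Cancelling [A i j] leaves [l' i * r' j = l i * r j], so the ratios [l' i / l i] and [r j / r' j]
    agree for all [i] and [j] and are therefore constant. *)
Lemma rdiag_scaling_unique m n (A : 'M[K]_(m, n))
    (l l' : 'rV[R]_m) (r r' : 'rV[R]_n) :
    (0 < m)%N -> (0 < n)%N -> elemental_nonzero A ->
    (forall i, 0 < l 0 i) -> (forall j, 0 < r' 0 j) ->
    rdiag l' *m A *m rdiag r' = rdiag l *m A *m rdiag r ->
  exists c, l' = c *: l /\ r = c *: r'.
Proof.
move=> m_gt0 n_gt0 A_nz l0 r'0 eqS.
have lr i j : l' 0 i * r' 0 j = l 0 i * r 0 j.
  apply: (@of_realK_inj _ k).
  have := congr1 (fun M : 'M_(m, n) => M i j) eqS.
  rewrite !mul_diag_mx !mul_mx_diag !mxE -!of_realKC !mulrA -!rmorphM.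
  have [y [_ Ay]] := base_ring_inv (A_nz i j).
  move/(congr1 ( *%R^~ y)); rewrite -!mulrA Ay !mulr1.
  by rewrite (mulrC (r' 0 j)) (mulrC (r 0 j)).
pose i0 := Ordinal m_gt0; pose j0 := Ordinal n_gt0.
(* The constant is read off at a reference row, which exists because the dimensions are positive. *)
exists (l' 0 i0 / l 0 i0).
have l_neq0 i : l 0 i != 0 by rewrite gt_eqF.
have r'_neq0 j : r' 0 j != 0 by rewrite gt_eqF.
have rE j : r 0 j = l' 0 i0 / l 0 i0 * r' 0 j.
  by apply: (mulfI (l_neq0 i0)); rewrite -lr; field.
split; apply/rowP => i; rewrite !mxE ?rE //.
by apply: (mulIf (r'_neq0 j0)); rewrite lr rE; ring.
Qed.

Lemma mxinvP n (D : 'M[K]_n) : nonsingular D -> is_mxinv D (mxinv D).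
Proof.
move=> [X XP]; rewrite /mxinv.
by case: classical_sets.xgetP => [Y _ //|/(_ X)].
Qed.

Lemma unitary_diag_inv n (U : 'M[K]_n) : unitary_diag U -> is_mxinv U (adjmx U).
Proof.
move=> [/is_diag_mxP Ud Uu].
have -> : U = diag_mx (\row_i U i i).
  apply/matrixP => i j; rewrite !mxE; have [<-|ij] := eqVneq i j.
    by rewrite mulr1n.
  by rewrite mulr0n Ud.
have -> : adjmx (diag_mx (\row_i U i i)) = diag_mx (\row_i conjK (U i i)).
  apply/matrixP => i j; rewrite !mxE eq_sym.
  by have [->|ij] := eqVneq i j; rewrite ?mulr1n // ?mulr0n raddf0.
split; rewrite mulmx_diag; apply/matrixP => i j; rewrite !mxE.
  by rewrite -{1}(conjKK (U i i)) conjK_mulV absK_conj Uu expr1n rmorph1.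
by rewrite conjK_mulV Uu expr1n rmorph1.
Qed.

(** Each diagonal entry is split as its phase times its absolute value. *)
Lemma diag_polar n (D : 'M[K]_n) : is_diag_mx D -> nonsingular D ->
  exists (U : 'M[K]_n) (d : 'rV[R]_n),
    [/\ unitary_diag U, forall i, 0 < d 0 i & D = U *m rdiag d].
Proof.
move=> /is_diag_mxP Dd [X [DX _]].
have D0 i : 0 < absK (D i i).
  rewrite lt_def absK_ge0 andbT absK_eq0; apply/eqP => Dii.
  (* A zero diagonal entry would give [D] a zero row, contradicting [D *m X = 1]. *)
  have DXii : (D *m X) i i = 0.
    rewrite mxE big1 // => j _.
    by have [<-|ij] := eqVneq i j; rewrite ?Dii ?Dd ?mul0r.
  by have /eqP := oner_neq0 K; apply; rewrite -DXii DX mxE eqxx.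
pose d := \row_i absK (D i i).
exists (rdiag (\row_i (absK (D i i))^-1) *m D), d; split.
- rewrite mul_diag_mx; split=> [|i].
    by apply/is_diag_mxP => i j ij; rewrite !mxE (Dd _ _ ij) mulr0.
  by rewrite !mxE absK_of_realM ?mulVf ?invr_ge0 ?absK_ge0 // gt_eqF.
- by move=> i; rewrite mxE.
- rewrite mul_diag_mx mul_mx_diag; apply/matrixP => i j; rewrite !mxE.
  rewrite -of_realKC mulrA -rmorphM.
  have [<-|ij] := eqVneq i j; last by rewrite (Dd _ _ ij) mulr0.
  by rewrite mulfV ?gt_eqF // rmorph1 mul1r.
Qed.

End DiagonalScaling.

(** * The Penrose identities and diagonal consistency of the generalized inverse *)

Section GeneralDiagonalInverse.
Variables (R : realType) (k : scalar_kind) (m n : nat).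
Local Notation K := (base_ring R k).
Local Notation rdiag d := (diag_mx (map_mx (@of_realK R k) d)).
Variables (DL : 'M[K]_(m, n) -> 'M[K]_m) (DR : 'M[K]_(m, n) -> 'M[K]_n).
Hypothesis DLR : scale_functions DL DR.

Lemma rdiag_inv p (d : 'rV[R]_p) : (forall i, 0 < d 0 i) ->
  exists X, is_mxinv (rdiag d) X.
Proof.
move=> d0; have d_neq0 i : d 0 i != 0 by rewrite gt_eqF.
exists (rdiag (\row_i (d 0 i)^-1)).
by split; rewrite rdiagMM; apply/matrixP => i j; rewrite !mxE ?mulfV ?mulVf ?rmorph1.
Qed.

Lemma uinv_penrose A : elemental_nonzero A ->
  A *m uinv DL DR A *m A = A /\
  uinv DL DR A *m A *m uinv DL DR A = uinv DL DR A.
Proof.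
move=> A_nz; rewrite /uinv.
have /pos_diagP[l l0 ->] := scale_posL DLR A_nz.
have /pos_diagP[r r0 ->] := scale_posR DLR A_nz.
have [L [lL Ll]] := rdiag_inv l0; have [Q [rQ Qr]] := rdiag_inv r0.
set S := rdiag l *m A *m rdiag r; have [SXS XSX _ _] := mppinvP S.
have AE : A = L *m S *m Q by rewrite /S !mulmxA Ll mul1mx -mulmxA rQ mulmx1.
clearbody S; have AX : A *m (rdiag r *m mppinv S *m rdiag l) = L *m (S *m mppinv S) *m rdiag l.
  by rewrite {1}AE -!mulmxA (mulmxA Q) Qr mul1mx.
rewrite -(mulmxA (_ *m rdiag l)) AX; split.
  rewrite {1 2}AE -!mulmxA (mulmxA (rdiag l)) lL mul1mx !mulmxA.
  by rewrite -(mulmxA L) -(mulmxA L) SXS -AE.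
rewrite -!mulmxA (mulmxA (rdiag l)) lL mul1mx; congr (_ *m _).
by rewrite !mulmxA XSX.
Qed.

(** Consistency is stated with [D] and [E] multiplied out, so that their polar factors can be
    handled without inverting them. *)
Lemma uinv_diag A D E : (0 < m)%N -> (0 < n)%N -> elemental_nonzero A ->
    is_diag_mx D -> nonsingular D -> is_diag_mx E -> nonsingular E ->
  E *m uinv DL DR (D *m A *m E) *m D = uinv DL DR A.
Proof.
move=> m_gt0 n_gt0 A_nz Dd Dn Ed En.
have [U [d [Uu d0 ->]]] := diag_polar Dd Dn.
have [V [e [Vu e0 ->]]] := diag_polar Ed En.
have [UU' U'U] := unitary_diag_inv Uu; have [VV' V'V] := unitary_diag_inv Vu.
have [[Udiag _] [Vdiag _]] := (Uu, Vu).
pose A' := rdiag d *m A *m rdiag e.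
have A'_nz : elemental_nonzero A' by exact: elemental_nonzero_rdiag.
(* Commuting [V] past the real factor puts both unitary parts outermost, where [DL] and [DR] ignore
   them. *)
have -> : U *m rdiag d *m A *m (V *m rdiag e) = U *m A' *m V.
  by rewrite -(rdiagC e Vdiag) /A' !mulmxA.
rewrite /uinv (scale_unitaryL DLR) // (scale_unitaryR DLR) //.
have pd : pos_diag (rdiag d) by apply/pos_diagP; exists d.
have pe : pos_diag (rdiag e) by apply/pos_diagP; exists e.
have := scale_inv DLR A_nz pd pe; rewrite /= -/A'.
have /pos_diagP[l l0 ->] := scale_posL DLR A_nz.
have /pos_diagP[r r0 ->] := scale_posR DLR A_nz.
have /pos_diagP[l' l'0 ->] := scale_posL DLR A'_nz.
have /pos_diagP[r' r'0 ->] := scale_posR DLR A'_nz.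
(* [ld] and [er] combine the scale factors of [A'] with [d] and [e], so they scale [A] itself to the
   same matrix as [l] and [r] do. *)
move=> eqS; pose ld := \row_i (l' 0 i * d 0 i); pose er := \row_i (e 0 i * r' 0 i).
have [||c [ldE rE]] := rdiag_scaling_unique (l' := ld) (r' := er) (r := r)
    m_gt0 n_gt0 A_nz l0.
- by move=> j; rewrite mxE mulr_gt0.
- by rewrite -rdiagMM -[rdiag er]rdiagMM -eqS /A' !mulmxA.
move: eqS; set S := rdiag l *m A *m rdiag r; clearbody S A' => eqS.
have -> : rdiag l' *m (U *m A' *m V) *m rdiag r' = U *m S *m V.
  by rewrite !mulmxA (rdiagC l' Udiag) -(mulmxA _ V) -(rdiagC r' Vdiag) -eqS !mulmxA.
rewrite mppinv_unitary //; move: (mppinv S) => X.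
(* Regrouped so that each unitary factor commutes past a real diagonal and meets its adjoint,
   leaving [rdiag er *m X *m rdiag ld]. *)
have -> : V *m rdiag e *m (rdiag r' *m (adjmx V *m X *m adjmx U) *m rdiag l')
    *m (U *m rdiag d)
  = V *m (rdiag e *m rdiag r') *m adjmx V *m X *m adjmx U
    *m (rdiag l' *m U) *m rdiag d by rewrite !mulmxA.
rewrite (rdiagC l' Udiag) rdiagMM -(rdiagC _ Vdiag) -(mulmxA _ V) VV' mulmx1.
rewrite !mulmxA -(mulmxA _ (adjmx U)) U'U mulmx1 -(mulmxA _ (rdiag l')) rdiagMM.
by rewrite -/ld -/er ldE rE rdiag_scale_mul.
Qed.

End GeneralDiagonalInverse.

Theorem mainTheorem2 (R : realType) (k : scalar_kind) (m n : nat)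
    (m_gt0 : (0 < m)%N) (n_gt0 : (0 < n)%N)
    (DL : 'M[base_ring R k]_(m, n) -> 'M[base_ring R k]_m)
    (DR : 'M[base_ring R k]_(m, n) -> 'M[base_ring R k]_n)
    (DLR_scale : scale_functions DL DR)
    (A : 'M[base_ring R k]_(m, n)) (A_nz : elemental_nonzero A)
    (D : 'M[base_ring R k]_m) (E : 'M[base_ring R k]_n)
    (D_diag : is_diag_mx D) (D_ns : nonsingular D)
    (E_diag : is_diag_mx E) (E_ns : nonsingular E) :
  [/\ A *m uinv DL DR A *m A = A,
      uinv DL DR A *m A *m uinv DL DR A = uinv DL DR A,
      uinv DL DR (D *m A *m E) = mxinv E *m uinv DL DR A *m mxinv D &
      mxrk (uinv DL DR A) = mxrk A].
Proof.
have [AXA XAX] := uinv_penrose DLR_scale A_nz.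
split=> //; last exact: mxrk_reflexive_inverse (@base_ring_inv R k) _ _ _ _ AXA XAX.
rewrite -(uinv_diag DLR_scale m_gt0 n_gt0 A_nz D_diag D_ns E_diag E_ns).
have [DD' _] := mxinvP D_ns; have [_ E'E] := mxinvP E_ns.
move: (uinv DL DR _) => X.
by rewrite -!mulmxA DD' mulmx1 !mulmxA E'E mul1mx.
Qed.
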